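(* Let $X$ be a real-valued $C_b$-Feller semimartingale with strongly continuous transition semigroup $(T_t)_{0\le t\le T}$. Let $\tilde f:\mathbb{R}\to\mathbb{R}$ be bounded and continuous such that $T_t\tilde f\in C^{1,2}$, i.e. $(t,x)\mapsto T_t\tilde f(x)$ is once continuously differentiable in $t$ and twice continuously differentiable in $x$. Let $f:(D([0,T],\mathbb{R}),\|\cdot\|_\infty)\to\mathbb{R}$ be the integral functional $f(\omega)=\int_0^T\tilde f(\omega_t)\,dt$. Then $G_f\in C^{1,2}_b(\Lambda_T)$, where $G_f(t,\omega)=E[f(X^T)\mid X^t=\omega^t]$.
   Context: Paths and functionals. Fix $T>0$. $D([0,T],\mathbb{R})$ is the space of càdlàg paths with $\|\omega\|_\infty=\sup_{u\in[0,T]}|\omega_u|$. $\omega^t:=\omega_{\cdot\wedge t}$ is the path stopped at $t$. The space of stopped paths is $\Lambda_T=\{(t,\omega^t):(t,\omega)\in[0,T]\times D([0,T],\mathbb{R})\}$ with metric $d_\infty((t,\omega^t),(s,\tilde\omega^s))=\|\omega^t-\tilde\omega^s\|_\infty+|t-s|$. A non-anticipative functional is a measurable map $F:\Lambda_T\to\mathbb{R}$; one writes $F(t,\omega)=F(t,\omega^t)$. Regularity. $F$ is continuous at fixed times if for every $t\in[0,T)$ the map $F(t,\cdot):(D([0,T],\mathbb{R}),\|\cdot\|_\infty)\to\mathbb{R}$ is continuous. $F$ is left-continuous, $F\in C^{0,0}_l(\Lambda_T)$, if it is continuous at fixed times and for all $(t,\omega)\in\Lambda_T$ and $\varepsilon>0$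 there is $\delta>0$ such that for all $(s,\tilde\omega)\in\Lambda_T$ with $s<t$ and $d_\infty((t,\omega),(s,\tilde\omega))<\delta$ one has $|F(t,\omega)-F(s,\tilde\omega)|<\varepsilon$. $F$ is boundedness preserving, $F\in B(\Lambda_T)$, if for every compact $K\subset\mathbb{R}$ and $t_0<T$ there is $C_{K,t_0}>0$ such that $|F(t,\omega)|\le C_{K,t_0}$ for all $t\le t_0$ and all $\omega$ with $\omega([0,t])\subset K$. Horizontal derivative: $\mathcal{D}F(t,\omega)=\lim_{h\downarrow0}\frac{F(t+h,\omega^t)-F(t,\omega^t)}{h}$ ($t<T$). Vertical derivative: $\nabla_\omega F(t,\omega)$ is the derivative at $x=0$ of $x\mapsto F(t,\omega^t+x\mathbf 1_{[t,T]})$, $x\in\mathbb{R}$; $\nabla^2_\omega F$ is obtained by iterating. $C^{1,2}_b(\Lambda_T)$ is the set of $F\in C^{0,0}_l(\Lambda_T)$ that are horizontally differentiable everywhere with $\mathcal{D}F$ continuous at fixed times, twice vertically differentiable with $\nabla_\omega F,\nabla^2_\omega F\in C^{0,0}_l(\Lambda_T)$, and with $\mathcal{D}F,\nabla_\omega F,\nabla^2_\omega F\in B(\Lambda_T)$. Feller semimartingales. A $C_b$-Feller semigroup is a strongly continuous semigroup on $C_b(\mathbb{R})$ (bounded continuous functions), in particular mapping $C_b(\mathbb{R})$ into $C_b(\mathbb{R})$. A $C_b$-Feller semimartingale is a semimartingale that is a time-homogeneous Markov process whose transition semigroup $T_tg(x)=E[g(X_t)\mid X_0=x]$ is a $C_b$-Feller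 semigroup. Probabilistic setting. $X$ is the canonical process on $D([0,T],\mathbb{R})$ with its natural filtration, is one-dimensional and starts in zero; $X^T$ denotes its whole path. It is assumed that a regular version $P^{X^T|X^t=\omega^t}$ of the conditional probability of $X^T$ given $X^t$ exists, and $G_f(t,\omega)=\int f(\tilde\omega)\,P^{X^T|X^t=\omega^t}(d\tilde\omega)$. The version meant is the one given by the transition semigroup (Markov property): the conditional expectation of $\tilde f(X_s)$ given $X^t=\omega^t$ is $T_{s-t}\tilde f(\omega_t)$ for $s\ge t$ and $\tilde f(\omega_s)$ for $s<t$. *)

(* Defs.v *)
From HB Require Import structures.
From mathcomp Require Import all_boot all_order all_algebra.
From mathcomp Require Import all_classical all_reals all_analysis.

Set Implicit Arguments.
Unset Strict Implicit.
Unset Printing Implicit Defensive.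

Import Order.TTheory GRing.Theory Num.Theory.
Import numFieldNormedType.Exports.

Local Open Scope classical_set_scope.
Local Open Scope ring_scope.

Definition cadlag (R : realType) (T : R) (f : R -> R) : Prop :=
  (forall t : R, 0 <= t < T -> f x @[x --> t^'+] --> f t) /\
  (forall t : R, 0 < t <= T -> cvg (f x @[x --> t^'-])).

(* A path on [0, T] is encoded by its extension by 0 to the real line, so that
   equality of paths is equality of their values on [0, T]. *)
Record Dpath (R : realType) (T : R) := MkDpath {
  Dpath_fun :> R -> R;
  Dpath_cadlag : cadlag T Dpath_fun;
  Dpath_restrict : patch (fun=> 0) `[0, T] Dpath_fun = Dpath_fun }.

Section Dpath.
Variables (R : realType) (T : R).
Implicit Types (f g : R -> R) (t : R) (w : Dpath T).

Lemma cadlag_restrict f : cadlag T f -> cadlag T (patch (fun=> 0) `[0, T] f).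
Proof.
move=> [fr fl]; split=> t /andP[t0 tT].
- rewrite patchE mem_set/=; last by rewrite in_itv/= t0 ltW.
  apply: cvg_trans (fr t _); last by rewrite t0.
  apply: near_eq_cvg; near=> x; rewrite patchE mem_set//= in_itv/=.
  apply/andP; split.
    by rewrite (le_trans t0)// ltW//; near: x; exact: nbhs_right_gt.
  by rewrite ltW//; near: x; exact: nbhs_right_lt.
- have /cvg_ex[/= l fl'] := fl t ltac:(by rewrite t0).
  apply/cvg_ex; exists l; apply: cvg_trans fl'.
  apply: near_eq_cvg; near=> x; rewrite patchE mem_set//= in_itv/=.
  apply/andP; split; first by rewrite ltW//; near: x; exact: nbhs_left_gt.
  by rewrite (le_trans _ tT)// ltW//; near: x; exact: nbhs_left_lt.
Unshelve. all: by end_near. Qed.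

Lemma restrict_idem f :
  patch (fun=> 0) `[0, T] (patch (fun=> 0) `[0, T] f) = patch (fun=> 0) `[0, T] f.
Proof. by apply/funext => x; rewrite !patchE; case: ifP => // ->. Qed.

Definition mkDpath f (cf : cadlag T f) : Dpath T :=
  MkDpath (cadlag_restrict cf) (restrict_idem f).

Lemma cadlag_stop f t : cadlag T f -> cadlag T (fun u => f (Num.min u t)).
Proof.
move=> [fr fl]; split=> s /andP[s0 sT].
- have [st|ts] := ltP s t.
  + apply: cvg_trans (fr s _); last by rewrite s0.
    apply: near_eq_cvg; apply: filterS (nbhs_right_lt st) => x xt.
    by rewrite min_l// ltW.
  + apply: cvg_near_cst; apply: filterS (nbhs_right_gt s) => x sx.
    by rewrite !min_r// (le_trans ts)// ltW.
- have [st|ts] := leP s t.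
  + have /cvg_ex[/= l fl'] := fl s ltac:(by rewrite s0).
    apply/cvg_ex; exists l; apply: cvg_trans fl'.
    apply: near_eq_cvg; apply: filterS (nbhs_left_lt s) => x xs.
    by rewrite min_l// (le_trans (ltW xs)).
  + apply/cvg_ex; exists (f t).
    apply: cvg_near_cst; apply: filterS (nbhs_left_gt ts) => x tx.
    by rewrite min_r// ltW.
Qed.

Lemma cadlag_step t (x : R) : cadlag T (fun u => if t <= u then x else 0).
Proof.
split=> s /andP[s0 sT].
- apply: cvg_near_cst; have [ts|st] := leP t s.
    by apply: filterS (nbhs_right_gt s) => u su; rewrite (le_trans ts (ltW su)).
  by apply: filterS (nbhs_right_lt st) => u ut; rewrite leNgt ut.
- apply/cvg_ex; exists (if t < s then x else 0).
  apply: cvg_near_cst; have [ts|st] := ltP t s.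
    by apply: filterS (nbhs_left_gt ts) => u tu; rewrite (ltW tu).
  by apply: filterS (nbhs_left_lt s) => u us; rewrite leNgt (lt_le_trans us st).
Qed.

Lemma cadlagD f g : cadlag T f -> cadlag T g -> cadlag T (f \+ g).
Proof.
move=> [fr fl] [gr gl]; split=> s sT.
- by apply: cvgD; [exact: fr|exact: gr].
- by apply: is_cvgD; [exact: fl|exact: gl].
Qed.

Definition stop t w : Dpath T := mkDpath (cadlag_stop t (Dpath_cadlag w)).

(* The vertically perturbed path [w^t + x 1_[t, T]]. *)
Definition vbump t (x : R) w : Dpath T :=
  mkDpath (cadlagD (cadlag_stop t (Dpath_cadlag w)) (cadlag_step t x)).

Definition sup_norm f : R := sup [set `|f u| | u in `[0, T]].

(* Càdlàg functions are bounded on [0, T], so [sup_norm] is a genuine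
   supremum on (differences of) paths. *)
Lemma cadlag_bounded f : cadlag T f ->
  exists M, forall u, u \in `[0, T] -> `|f u| <= M.
Proof.
move=> [fr fl].
have cK : compact `[0, T]%classic by exact: segment_compact.
have H : forall x, `[0, T]%classic x ->
  exists M, \forall u \near x, u \in `[0, T] -> `|f u| <= M.
  move=> x; rewrite /= in_itv/= => /andP[x0 xT].
  have [Ml Hl] : exists M, \forall u \near x^'-, u \in `[0, T] -> `|f u| <= M.
    have [x1|x1] := eqVneq x 0.
      exists 0; near=> u; rewrite in_itv/= => /andP[u0 _].
      suff : u < 0 by rewrite ltNge u0.
      by rewrite -x1; near: u; exact: nbhs_left_lt.
    have /cvg_ex[/= l fl'] := fl x ltac:(by rewrite lt_neqAle eq_sym x1 x0 xT).
    have l1 : `|l| < `|l| + 1 by rewrite ltrDl.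
    exists (`|l| + 1).
    have := @cvgr_norm_lt _ R^o _ _ _ _ _ fl' _ l1.
    by move=> h; near=> u => _; apply: ltW; near: u; exact: h.
  have [Mr Hr] : exists M, \forall u \near x^'+, u \in `[0, T] -> `|f u| <= M.
    have [x1|x1] := eqVneq x T.
      exists 0; near=> u; rewrite in_itv/= => /andP[_ u0].
      suff : T < u by rewrite ltNge u0.
      by rewrite -x1; near: u; exact: nbhs_right_gt.
    have fr' := fr x ltac:(by rewrite lt_neqAle x1 x0 xT).
    have l1 : `|f x| < `|f x| + 1 by rewrite ltrDl.
    exists (`|f x| + 1).
    have := @cvgr_norm_lt _ R^o _ _ _ _ _ fr' _ l1.
    by move=> h; near=> u => _; apply: ltW; near: u; exact: h.
  exists (Num.max `|f x| (Num.max Ml Mr)).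
  near=> u => uT; rewrite !le_max.
  have [ux|xu|->] := ltgtP u x; last by rewrite lexx.
  - suff -> : `|f u| <= Ml by rewrite orbT.
    by move: ux uT; near: u.
  - suff -> : `|f u| <= Mr by rewrite !orbT.
    by move: xu uT; near: u.
have [] := (compact_near_coveringP _).1 cK R +oo
    (fun M u => u \in `[0, T] -> `|f u| <= M) _ _.
- move=> x /H[M HM].
  exists ([set u | u \in `[0, T] -> `|f u| <= M], [set M' | M <= M']).
    by split => //=; apply: nbhs_pinfty_ge; exact: num_real.
  by move=> [u M'] /= [uM MM'] uT; exact: le_trans (uM uT) MM'.
- move=> M [_ HM]; exists (M + 1) => u uT.
  by apply: (HM (M + 1) _ u) => //; rewrite ltrDl.
Unshelve. all: by end_near. Qed.

End Dpath.

Lemma cadlag_cst (R : realType) (T c : R) : cadlag T (fun=> c).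
Proof.
by split=> t _; [exact: cvg_cst|apply/cvg_ex; exists c; exact: cvg_cst].
Qed.

HB.instance Definition _ (R : realType) (T : R) := gen_eqMixin (Dpath T).
HB.instance Definition _ (R : realType) (T : R) := gen_choiceMixin (Dpath T).
HB.instance Definition _ (R : realType) (T : R) :=
  isPointed.Build (Dpath T) (mkDpath (cadlag_cst T 0)).

Definition coord_process (R : realType) (T : R) (t : R) (w : Dpath T) : R := w t.

Definition natural_filtration (R : realType) (Omega : Type)
    (X : R -> Omega -> R) (t : R) : set (set Omega) :=
  <<s \bigcup_(s in `[0, t]) preimage_set_system setT (X s) measurable >>.

Definition coordinate_sets (R : realType) (T : R) : set (set (Dpath T)) :=
  \bigcup_(t in `[0, T])
    preimage_set_system setT (@coord_process R T t) measurable.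

HB.instance Definition _ (R : realType) (T : R) :=
  @isMeasurable.Build (sigma_display (@coordinate_sets R T)) (Dpath T)
    <<s @coordinate_sets R T >>
    (@sigma_algebra0 _ setT _) (@sigma_algebraC _ _)
    (@sigma_algebra_bigcup _ setT _).

Section Semimartingale.
Context (d : measure_display) (Omega : measurableType d) (R : realType).
Variables (P : probability Omega R) (T : R).
Implicit Types (G : set (set Omega)) (F : R -> set (set Omega)).
Implicit Types (X M : R -> Omega -> R) (tau : Omega -> R).

(* [Z] is a version of the conditional expectation of [Y] given [G]. *)
Definition is_cond_exp G (Y Z : Omega -> R) : Prop :=
  [/\ forall B, measurable B -> G (Z @^-1` B),
      P.-integrable setT (EFin \o Y),
      P.-integrable setT (EFin \o Z)
    & forall A, G A ->
        (\int[P]_(w in A) (Y w)%:E = \int[P]_(w in A) (Z w)%:E)%E].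

Definition adapted F X : Prop :=
  forall (t : R) B, 0 <= t <= T -> measurable B -> F t (X t @^-1` B).

Definition cadlag_process X : Prop :=
  {ae P, forall w, cadlag T (fun t => X t w)}.

Definition martingale F M : Prop :=
  adapted F M /\
  forall s t : R, 0 <= s -> s <= t -> t <= T -> is_cond_exp (F s) (M t) (M s).

Definition stopping_time F tau : Prop :=
  (forall w, 0 <= tau w) /\
  forall t : R, 0 <= t <= T -> F t [set w | tau w <= t].

(* On the compact horizon [0, T], a localizing sequence is one that
   eventually reaches [T]; stopping times may therefore be taken real-valued,
   any value [>= T] meaning that no stopping occurs. *)
Definition local_martingale F M : Prop :=
  [/\ adapted F M, cadlag_process M
    & exists tau : nat -> Omega -> R,
      [/\ forall n, stopping_time F (tau n),
          {ae P, forall w, {homo tau ^~ w : m n / (m <= n)%N >-> m <= n}},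
          {ae P, forall w, exists n, T <= tau n w}
        & forall n,
            martingale F (fun t w => M (Num.min t (tau n w)) w - M 0 w)]].

Definition finite_variation_process F (A : R -> Omega -> R) : Prop :=
  [/\ adapted F A, cadlag_process A
    & {ae P, forall w, bounded_variation 0 T (fun t => A t w)}].

Definition semimartingale F X : Prop :=
  [/\ adapted F X, cadlag_process X
    & exists M A, [/\ local_martingale F M, finite_variation_process F A,
        {ae P, forall w, M 0 w = 0 /\ A 0 w = 0}
      & {ae P, forall w, forall t : R, 0 <= t <= T ->
          X t w = X 0 w + M t w + A t w}]].

End Semimartingale.

Section Feller.
Variables (R : realType) (T : R).

Definition Cb (g : R -> R) : Prop :=
  continuous g /\ exists M : R, forall x, `|g x| <= M.

(* [p t x] is the law of [X_t] given [X_0 = x], and [semigroup p t g x] is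
   [T_t g (x) = E[g(X_t) | X_0 = x]]. *)
Definition semigroup (p : R -> R.-pker R ~> R)
    (t : R) (g : R -> R) (x : R) : R :=
  \int[p t x]_y g y.

(* Linearity and contractivity on [Cb] are automatic, the operators being
   integrals against probability kernels. *)
Definition Cb_Feller (p : R -> R.-pker R ~> R) : Prop :=
  [/\ forall (t : R) g, 0 <= t <= T -> Cb g -> Cb (semigroup p t g),
      forall g, Cb g -> semigroup p 0 g = g,
      forall (s t : R) g, 0 <= s -> 0 <= t -> s + t <= T -> Cb g ->
        semigroup p (s + t) g = semigroup p s (semigroup p t g)
    & forall g, Cb g ->
        sup [set `|semigroup p t g x - g x| | x in setT] @[t --> 0^'+] --> 0].

Definition markov_process (d : measure_display) (Omega : measurableType d)
    (P : probability Omega R) (F : R -> set (set Omega)) (X : R -> Omega -> R)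
    (p : R -> R.-pker R ~> R) : Prop :=
  forall (s t : R) g, 0 <= s -> s <= t -> t <= T -> Cb g ->
    is_cond_exp P (F s) (g \o X t) (semigroup p (t - s) g \o X s).

Definition Cb_Feller_semimartingale (d : measure_display)
    (Omega : measurableType d) (P : probability Omega R)
    (F : R -> set (set Omega)) (X : R -> Omega -> R)
    (p : R -> R.-pker R ~> R) : Prop :=
  [/\ semimartingale P T F X, markov_process P F X p & Cb_Feller p].

(* [u] is of class [C^{1,2}] on [0, T] x R; time derivatives are one-sided at
   [0] and [T]. *)
Definition C12 (u : R -> R -> R) : Prop :=
  exists ut : R -> R -> R,
  [/\ forall t x : R, 0 <= t <= T ->
        (u s x - u t x) / (s - t) @[s --> within `[0, T] t^'] --> ut t x,
      forall t x : R, 0 <= t <= T ->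
        derivable (u t) x 1 /\ derivable (derive1 (u t)) x 1,
      {within `[0, T] `*` setT, continuous (fun z : R * R => u z.1 z.2)},
      {within `[0, T] `*` setT, continuous (fun z : R * R => ut z.1 z.2)}
    & {within `[0, T] `*` setT,
        continuous (fun z : R * R => derive1 (u z.1) z.2)} /\
      {within `[0, T] `*` setT,
        continuous (fun z : R * R => derive1 (derive1 (u z.1)) z.2)}].

End Feller.

(* A functional on the space of stopped paths is represented by a function on
   [R * Dpath T], of which only the values on [stopped_paths T] matter;
   [F(t, w)] is written [F (t, stop t w)]. *)
Section Functional.
Variables (R : realType) (T : R).
Implicit Types (F : R * Dpath T -> R).

Definition stopped_paths : set (R * Dpath T) :=
  [set p : R * Dpath T | 0 <= p.1 <= T /\ stop p.1 p.2 = p.2].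

Definition d_infty (p q : R * Dpath T) : R :=
  sup_norm T (p.2 \- q.2) + `|p.1 - q.1|.

Definition d_infty_open : set (set (R * Dpath T)) :=
  [set U | U `<=` stopped_paths /\ forall p, U p ->
    exists2 e, 0 < e &
      forall q, stopped_paths q -> d_infty p q < e -> U q].

(* Measurability for the Borel sigma-algebra of the metric [d_infty]. *)
Definition nonanticipative F : Prop :=
  forall B, measurable B -> <<s stopped_paths, d_infty_open >>
    (stopped_paths `&` F @^-1` B).

Definition continuous_at_fixed_times F : Prop :=
  forall (t : R) (w : Dpath T), 0 <= t < T ->
  forall e : R, 0 < e -> exists2 delta, 0 < delta &
  forall w' : Dpath T, sup_norm T (w \- w') < delta ->
    `|F (t, stop t w) - F (t, stop t w')| < e.

(* [C^{0,0}_l] *)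
Definition left_continuous F : Prop :=
  [/\ nonanticipative F, continuous_at_fixed_times F
    & forall p, stopped_paths p ->
      forall e : R, 0 < e -> exists2 delta, 0 < delta &
      forall q, stopped_paths q -> q.1 < p.1 -> d_infty p q < delta ->
        `|F p - F q| < e].

Definition boundedness_preserving F : Prop :=
  nonanticipative F /\
  forall (K : set R) t0, compact K -> t0 < T ->
  exists2 C, 0 < C &
  forall (t : R) (w : Dpath T), 0 <= t <= t0 ->
    (forall u, 0 <= u <= t -> K (w u)) -> `|F (t, stop t w)| <= C.

Definition horizontal_quotient F (p : R * Dpath T) (h : R) : R :=
  (F (p.1 + h, stop p.1 p.2) - F (p.1, stop p.1 p.2)) / h.

Definition horizontally_differentiable F : Prop :=
  forall p, stopped_paths p -> p.1 < T ->
  cvg (horizontal_quotient F p h @[h --> 0^'+]).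

(* The horizontal derivative only makes sense for [t < T]; it is set to [0] at
   [t = T], a value which affects none of the notions below. *)
Definition horizontal_derivative F (p : R * Dpath T) : R :=
  if p.1 < T then lim (horizontal_quotient F p h @[h --> 0^'+]) else 0.

Definition vertically_differentiable F : Prop :=
  forall p, stopped_paths p ->
  derivable (fun x => F (p.1, vbump p.1 x p.2)) 0 1.

Definition vertical_derivative F (p : R * Dpath T) : R :=
  derive1 (fun x => F (p.1, vbump p.1 x p.2)) 0.

(* [C^{1,2}_b] *)
Definition C12b F : Prop :=
  [/\ left_continuous F,
      horizontally_differentiable F,
      continuous_at_fixed_times (horizontal_derivative F) /\
        boundedness_preserving (horizontal_derivative F),
      [/\ vertically_differentiable F,
          left_continuous (vertical_derivative F)
        & boundedness_preserving (vertical_derivative F)]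
    & [/\ vertically_differentiable (vertical_derivative F),
          left_continuous (vertical_derivative (vertical_derivative F))
        & boundedness_preserving (vertical_derivative (vertical_derivative F))]].

End Functional.

Section Conditional.
Variables (R : realType) (T : R).

Definition integral_functional (g : R -> R) (w : Dpath T) : R :=
  \int[lebesgue_measure]_(t in `[0, T]) g (w t).

(* [Q (t, w^t)] is a regular version of the law under [P] of the whole path
   given the path stopped at [t]. *)
Definition regular_conditional_law (P : probability (Dpath T) R)
    (Q : R * Dpath T -> probability (Dpath T) R) : Prop :=
  forall t : R, 0 <= t <= T -> forall B, measurable B ->
    is_cond_exp P (natural_filtration (@coord_process R T) t)
      (\1_B) (fun w => fine (Q (t, stop t w) B)).

(* The version of the conditional law given by the transition semigroup, as
   far as the one-dimensional marginals tested against [g] are concerned. *)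
Definition semigroup_version
    (p : R -> R.-pker R ~> R)
    (g : R -> R) (Q : R * Dpath T -> probability (Dpath T) R) : Prop :=
  forall (t : R) w, stopped_paths (t, w) -> forall s : R, 0 <= s <= T ->
    \int[Q (t, w)]_w' g (w' s) =
      if t <= s then semigroup p (s - t) g (w t) else g (w s).

Definition cond_functional (Q : R * Dpath T -> probability (Dpath T) R)
    (f : Dpath T -> R) (q : R * Dpath T) : R :=
  \int[Q q]_w f w.

End Conditional.

(* Main.v *)
Require Import Defs.
From mathcomp Require Import all_boot all_order all_algebra.
From mathcomp Require Import all_classical all_reals all_analysis.
From mathcomp Require Import measurable_realfun lebesgue_integral_under.
From mathcomp Require Import ring lra.

Set Implicit Arguments.
Unset Strict Implicit.
Unset Printing Implicit Defensive.

Import Order.TTheory GRing.Theory Num.Theory.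
Import numFieldNormedType.Exports.

Local Open Scope classical_set_scope.
Local Open Scope ring_scope.

(** Write u(s, x) for the semigroup applied to ft, at time s and point x.  The
    conditional expectation is computed in closed form, and its regularity is
    then read off from the formula.

    Given the path w stopped at t, the expectation of ft(X_s) is ft(w_s) for
    s < t and u(s - t, w_t) for s >= t.  Exchanging expectation and time
    integral ([Fubini_time]) and shifting time ([time_shift_integral]) gives,
    on stopped paths ([cond_functionalE]),

      G(t, w) = int_0^t ft(w_s) ds + J(T - t, w_t),
      J(r, x) = int_0^r u(s, x) ds.

    A vertical bump at time t alters the first term only at the single instant
    t, hence not at all, and replaces w_t by w_t + x in the second.  The
    vertical derivatives are therefore the x-derivatives of J, that is the
    time integrals of the x-derivatives of u ([time_integral_derive]).
    Extending the stopped path horizontally by h adds h ft(w_t) to the first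
    term and shortens the horizon of the second by h, so that the horizontal
    derivative is ft(w_t) - u(T - t, w_t) ([horizontal_quotient_cvg]).

    All three derivatives are thus of the form K(t, w_t) with K continuous on
    the strip [0, T] x R.  A stopped path satisfies w_t = w_T, so that
    its endpoint is a 1-Lipschitz function of the stopped path for the metric
    d_infty; such a functional is consequently continuous for d_infty, hence
    measurable, continuous at fixed times and left-continuous, and it preserves
    boundedness because K is bounded on compact subsets of the strip
    ([markovian_regular]).  The past integral is continuous for d_infty as well
    ([past_integral_continuous]), which settles G itself. *)

(** * Values of paths, and the uniform norm *)

Lemma Dpath_out (R : realType) (T : R) (w : Dpath T) u :
  u \notin `[0, T] -> w u = 0.
Proof.
move=> uT; rewrite -(Dpath_restrict w) patchE ifF//.
by apply/negbTE; rewrite notin_setE/=; apply/negP.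
Qed.

Lemma stopE (R : realType) (T t u : R) (w : Dpath T) :
  u \in `[0, T] -> stop t w u = w (Num.min u t).
Proof. by move=> uT; rewrite /= patchE mem_set. Qed.

Lemma vbumpE (R : realType) (T t x u : R) (w : Dpath T) : u \in `[0, T] ->
  vbump t x w u = w (Num.min u t) + (if t <= u then x else 0).
Proof. by move=> uT; rewrite /= patchE mem_set. Qed.

(** Paths carry proofs, so extensionality rests on proof irrelevance; the values
    outside [0, T] are pinned to 0 by the encoding. *)
Lemma Dpath_eq (R : realType) (T : R) (w w' : Dpath T) :
  {in `[0, T], w =1 w'} -> w = w'.
Proof.
move=> ww'.
have E : Dpath_fun w = Dpath_fun w'.
  apply/funext => u; have [uT|uT] := boolP (u \in `[0, T]); first exact: ww'.
  by rewrite !Dpath_out.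
case: w w' E {ww'} => f cf rf [g cg rg] /= E; subst g.
by rewrite (Prop_irrelevance cf cg) (Prop_irrelevance rf rg).
Qed.

Lemma Dpath_bounded (R : realType) (T : R) (w : Dpath T) :
  exists M, forall u, `|w u| <= M.
Proof.
have [M HM] := cadlag_bounded (Dpath_cadlag w).
exists (Num.max M 0) => u; rewrite le_max.
have [uT|uT] := boolP (u \in `[0, T]); first by rewrite HM.
by rewrite Dpath_out// normr0 lexx orbT.
Qed.

Lemma le_sup_norm (R : realType) (T u : R) (w w' : Dpath T) :
  u \in `[0, T] -> `|w u - w' u| <= sup_norm T (w \- w').
Proof.
move=> uT; rewrite /sup_norm; apply: ub_le_sup; last by exists u.
have [M HM] := Dpath_bounded w; have [M' HM'] := Dpath_bounded w'.
exists (M + M') => _ [v vT <-]; rewrite (le_trans (ler_normB _ _))//.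
exact: lerD.
Qed.

Lemma sup_norm_le (R : realType) (T C : R) (f : R -> R) : 0 <= T ->
  (forall u, u \in `[0, T] -> `|f u| <= C) -> sup_norm T f <= C.
Proof.
move=> T0 fC; apply: ge_sup.
  by exists `|f 0|, 0 => //=; rewrite in_itv/= lexx.
by move=> _ [u uT <-]; exact: fC.
Qed.

(** * Exchanging expectation and time integral *)

Lemma measurable_coord (R : realType) (T s : R) :
  measurable_fun setT (fun w : Dpath T => w s).
Proof.
have [sT|sT] := boolP (s \in `[0, T]); last first.
  rewrite (_ : (fun w : Dpath T => _) = cst 0)//.
  by apply/funext => w; rewrite Dpath_out.
move=> _ B mB; apply: sub_sigma_algebra; exists s => //.
by exists B.
Qed.

(** By right-continuity, a path at time s is the limit of its values on the grid
    of mesh 1/(n+1) at the first grid point strictly after s, truncated at T.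
    Each approximation depends on s only through its grid cell, so it is
    measurable in (s, w) cell by cell. *)
Lemma measurable_eval (R : realType) (T : R) : 0 <= T ->
  measurable_fun setT (fun z : R * Dpath T => z.2 z.1).
Proof.
move=> T0.
pose D : set (R * Dpath T) := `[0, T]%classic `*` setT.
have mD : measurable D by apply: measurableX.
(* Paths vanish outside [0, T], so only the times in [0, T] matter. *)
suff mev : measurable_fun D (fun z : R * Dpath T => z.2 z.1).
  have -> : (fun z : R * Dpath T => z.2 z.1) =
     (fun z => z.2 z.1) \_ D.
    apply/funext => -[s w]; rewrite patchE/=; case: ifPn => //.
    rewrite notin_setE => nD; rewrite Dpath_out//.
    by apply/negP => sT; apply: nD.
  exact/(measurable_restrictT _ mD).
pose e n (z : R * Dpath T) : R :=
  z.2 (Num.min T ((Num.truncn (n.+1%:R * z.1)).+1%:R / n.+1%:R)).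
apply: (@measurable_fun_cvg _ _ _ D e) => [n _ B mB|[s w] [/= sT _]].
  have -> : D `&` e n @^-1` B = \bigcup_(k : nat)
    ((`[0, T] `&` `[k%:R / n.+1%:R, k.+1%:R / n.+1%:R[) `*`
     [set w : Dpath T | B (w (Num.min T (k.+1%:R / n.+1%:R)))]).
    have trE (s : R) k : 0 <= s -> s \in `[k%:R / n.+1%:R, k.+1%:R / n.+1%:R[ ->
        Num.truncn (n.+1%:R * s) = k.
      move=> s0; rewrite in_itv => /andP[]/=.
      rewrite ler_pdivrMr// ltr_pdivlMr// => h1 h2.
      by apply: Num.Theory.truncn_def; rewrite mulrC h1 h2.
    apply/seteqP; split => -[s w] /=.
      move=> [[/= sT _] Bw]; exists (Num.truncn (n.+1%:R * s)) => //.
      split => //=.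
      split => //; rewrite in_itv/= ler_pdivrMr// ltr_pdivlMr// mulrC.
      apply: Num.Theory.truncn_itv; rewrite mulr_ge0//.
      by move: sT; rewrite in_itv => /andP[].
    move=> [k _ [/= [sT sk] Bw]]; split => //; rewrite /e/= (trE s k)//.
    by move: sT; rewrite in_itv => /andP[].
  apply: bigcup_measurable => k _; apply: measurableX.
    by apply: measurableI.
  by rewrite -[X in measurable X]setTI; exact: measurable_coord.
(* At s = T there is nothing to the right; the truncation makes the sequence
   constant. *)
have [sE|sT'] := eqVneq s T.
  apply: cvg_near_cst; near=> n.
  rewrite /e/= min_l ?sE// ler_pdivlMr// ltW// mulrC Num.Theory.truncnS_gt//.
have sltT : s < T by rewrite lt_neqAle sT'; move: sT; rewrite in_itv => /andP[].
have s0 : 0 <= s by move: sT; rewrite in_itv => /andP[].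
have [wr _] := Dpath_cadlag w.
have /= := wr s; rewrite s0 sltT => /(_ isT) wrs.
pose a n := Num.min T ((Num.truncn (n.+1%:R * s)).+1%:R / n.+1%:R).
apply: (@cvg_comp _ _ _ a w \oo s^'+ (nbhs (w s))) => //.
have sa n : s < a n.
  by rewrite lt_min sltT ltr_pdivlMr// mulrC Num.Theory.truncnS_gt.
have as1 n : a n <= s + n.+1%:R^-1.
  rewrite ge_min; apply/orP; right.
  rewrite ler_pdivrMr// mulrDl mulVf// -natr1 lerD2r mulrC.
  by rewrite Num.Theory.truncn_le mulr_ge0.
have acvg : a @ \oo --> s.
  apply: (@squeeze_cvgr _ _ _ _ (cst s) (fun n => s + n.+1%:R^-1)).
  - by near=> n; rewrite as1 /= ltW.
  - exact: cvg_cst.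
  - rewrite -[X in _ --> X]addr0; apply: cvgD; first exact: cvg_cst.
    exact: cvg_harmonic.
(* The strict inequality s < a n turns convergence into convergence from the
   right. *)
move=> U /= sU.
have aU : \forall n \near \oo, s < a n -> U (a n) by exact: (acvg _ sU).
by near=> n; apply: (near aU n) => //; exact: sa.
Unshelve. all: by end_near. Qed.

Lemma measurable_Dpath (R : realType) (T : R) (w : Dpath T) : 0 <= T ->
  measurable_fun setT (w : R -> R).
Proof.
move=> T0.
rewrite (_ : (w : R -> R) = (fun z : R * Dpath T => z.2 z.1) \o pair^~ w)//.
by apply: measurableT_comp; [exact: measurable_eval|exact: measurable_pair2].
Qed.

Lemma bounded_integrable (d : measure_display) (X : measurableType d)
    (R : realType) (mu : {measure set X -> \bar R}) (A : set X) (f : X -> R)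
    (M : R) :
  measurable A -> (mu A < +oo)%E -> measurable_fun A f ->
  (forall x, A x -> `|f x| <= M) -> mu.-integrable A (EFin \o f).
Proof.
move=> mA muA mf fM; apply: measurable_bounded_integrable => //.
exists M; split; first exact: num_real.
by move=> N MN x Ax; rewrite /= (le_trans (fM _ Ax))// ltW.
Qed.

(** The integrand is bounded and the product measure is finite on the time
    interval, so Fubini's theorem applies as soon as evaluation is jointly
    measurable. *)
Lemma Fubini_time (R : realType) (T M : R) (q : probability (Dpath T) R)
    (g : R -> R) : 0 <= T -> measurable_fun setT g -> (forall x, `|g x| <= M) ->
  \int[q]_w (\int[lebesgue_measure]_(s in `[0, T]) g (w s)) =
  \int[lebesgue_measure]_(s in `[0, T]) \int[q]_w g (w s).
Proof.
move=> T0 mg gM.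
have M0 : 0 <= M by rewrite (le_trans _ (gM 0)).
pose mu := @lebesgue_measure R.
pose f (z : R * Dpath T) : \bar R :=
  (\1_(`[0, T]%classic : set R) z.1 * g (z.2 z.1))%:E.
have muT : (mu `[0%R, T]%classic < +oo)%E.
  by rewrite /mu lebesgue_measure_itv/=; case: ifP; rewrite ?ltry.
have mf : measurable_fun setT f.
  apply/measurable_EFinP; apply: measurable_funM.
    by apply: measurableT_comp => //; exact: measurable_indic.
  by apply: measurableT_comp => //; exact: measurable_eval.
have intw (w : Dpath T) :
    (\int[mu]_(s in `[0%R, T]) (g (w s))%:E = \int[mu]_s f (s, w))%E.
  rewrite integral_mkcond; apply: eq_integral => s _.
  by rewrite /f patchE indicE/=; case: ifPn => h; rewrite ?mul1r ?mul0r.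
have ints (s : R) : (\int[q]_w f (s, w) = if s \in (`[0%R, T]%classic : set R)
     then \int[q]_w (g (w s))%:E else 0)%E.
  rewrite /f/= indicE; case: ifPn => h; last first.
    by under eq_integral do rewrite mul0r; rewrite integral0.
  by under eq_integral do rewrite mul1r.
have iw (w : Dpath T) : mu.-integrable `[0, T] (EFin \o (g \o w)).
  apply: (@bounded_integrable _ _ _ _ _ _ M) => //.
    apply: measurable_funTS; apply: measurableT_comp => //.
    exact: measurable_Dpath.
  by move=> x _; exact: gM.
have ig (s : R) : q.-integrable setT (EFin \o (fun w : Dpath T => g (w s))).
  apply: (@bounded_integrable _ _ _ _ _ _ M) => //.
    by rewrite (le_lt_trans (probability_le1 _ _))// ltry.
  by apply: measurableT_comp => //; exact: measurable_coord.
have fi : (mu \x q)%E.-integrable setT f.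
  apply/integrable12ltyP => //=.
  apply: (@le_lt_trans _ _ (\int[mu]_(s in `[0%R, T]) M%:E)%E); last first.
    by rewrite integral_cst// lte_mul_pinfty.
  rewrite [leRHS]integral_mkcond; apply: ge0_le_integral => //.
  - by move=> s _; exact: integral_ge0.
  - apply: (@measurable_fun_fubini_tonelli_F _ _ _ _ _ q
      (fun z => `|f z|%E)) => //.
    exact: measurableT_comp.
  - by apply/(measurable_restrictT _ (measurable_itv _)); exact: measurable_cst.
  - move=> s _; rewrite patchE /f/= indicE.
    case: ifPn => h.
      rewrite (le_trans _ (_ : (\int[q]_w M%:E <= _)%E))//; last first.
        by rewrite integral_cst//= probability_setT mule1.
      apply: ge0_le_integral => //.
      + apply/measurable_EFinP; apply: measurableT_comp => //.
        under eq_fun do rewrite mul1r.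
        by apply: measurableT_comp => //; exact: measurable_coord.
      + by move=> w _; rewrite mul1r lee_fin.
    by under eq_integral do rewrite mul0r normr0; rewrite integral0.
rewrite /Rintegral -/mu; congr fine.
have -> : (\int[q]_x (fine (\int[mu]_(x0 in `[0%R, T]) (g (x x0))%:E))%:E =
   \int[q]_w \int[mu]_s f (s, w))%E.
  apply: eq_integral => w _; rewrite fineK ?intw//.
  rewrite -intw; apply: integrable_fin_num; first exact: measurable_itv.
  exact: iw.
rewrite -Fubini// [RHS]integral_mkcond; apply: eq_integral => s _.
rewrite ints patchE; case: ifP => // _.
by rewrite fineK//; apply: integrable_fin_num; [exact: measurableT|exact: ig].
Qed.

(** * Functions continuous on the strip [0, T] x R *)

Definition strip_continuous (R : realType) (T : R) (V : R -> R -> R) : Prop :=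
  {within `[0, T] `*` setT, continuous (fun z : R * R => V z.1 z.2)}.

Lemma strip_continuousP (R : realType) (T : R) (V : R -> R -> R) :
  strip_continuous T V <->
  forall t x, t \in `[0, T] -> forall e, 0 < e -> exists2 d, 0 < d &
    forall s y, s \in `[0, T] -> `|t - s| < d -> `|x - y| < d ->
      `|V t x - V s y| < e.
Proof.
rewrite /strip_continuous; split.
  move=> /subspace_continuousP cV t x tT e e0.
  have /cvgrPdist_lt/(_ _ e0)/nbhs_ballP[d /= d0 dV] := cV (t, x) (conj tT I).
  exists d => // s y sT ts xy; apply: (dV (s, y)) => //.
move=> H; apply/subspace_continuousP => -[t x] [/= tT _].
apply/cvgrPdist_lt => e e0; have [d d0 dV] := H t x tT e e0.
apply/nbhs_ballP; exists d => //= -[s y] [/= ts xy] [/= sT _].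
exact: dV.
Qed.

(** Continuity in x is uniform in the time variable because [0, T] is
    compact. *)
Lemma strip_uniform (R : realType) (T : R) (V : R -> R -> R) (x e : R) :
  strip_continuous T V -> 0 < e -> exists2 d, 0 < d &
    forall s y, s \in `[0, T] -> `|x - y| < d -> `|V s x - V s y| < e.
Proof.
move=> /strip_continuousP cV e0.
have cK : compact (`[0, T]%classic : set R) by exact: segment_compact.
have e2 : 0 < e / 2 by rewrite divr_gt0.
have := (compact_near_coveringP _).1 cK R (nbhs x)
   (fun y s => s \in `[0, T] -> `|V s x - V s y| < e) _.
move=> /(_ _)[].
  move=> s /= sT; have [d d0 dV] := cV s x sT _ e2.
  exists (ball s d, ball x d); first by split; exact: nbhsx_ballx.
  move=> [s' y] /= [ss' xy] s'T.
  rewrite (splitr e); apply: (le_lt_trans (ler_distD (V s x) _ _)).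
  apply: ltrD; last exact: dV.
  by rewrite distrC; apply: dV => //; rewrite subrr normr0.
move=> d /= d0 dV; exists d => // s y sT xy.
exact: (dV y xy s sT sT).
Qed.

Lemma strip_bounded (R : realType) (T : R) (V : R -> R -> R) (K : set R) :
  strip_continuous T V -> compact K -> exists2 C, 0 < C &
    forall t x, t \in `[0, T] -> K x -> `|V t x| <= C.
Proof.
move=> cV cK.
have cT : compact (`[0, T]%classic `*` K).
  by apply: compact_setX => //; exact: segment_compact.
have cV' : {within `[0, T]%classic `*` K,
    continuous (fun z : R * R => V z.1 z.2)}.
  by apply: continuous_subspaceW cV; move=> z [].
have [M [Mr MV]] := compact_bounded (continuous_compact cV' cT).
exists (Num.max M 0 + 1); first by rewrite ltr_pwDr// le_max lexx orbT.
move=> t x tT Kx; apply: MV; last by exists (t, x).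
by rewrite (le_lt_trans (y := Num.max M 0)) ?ltrDl// le_max lexx.
Qed.

Lemma strip_section (R : realType) (T x : R) (V : R -> R -> R) :
  strip_continuous T V -> {within `[0, T], continuous (V^~ x)}.
Proof.
move=> /strip_continuousP cV; apply/subspace_continuousP => t /= tT.
apply/cvgrPdist_lt => e e0; have [d d0 dV] := cV t x tT e e0.
apply/nbhs_ballP; exists d => //= s ts sT.
by apply: dV => //; rewrite subrr normr0.
Qed.

Arguments strip_section {R T} x {V}.

Lemma strip_integrable (R : realType) (T r x : R) (V : R -> R -> R) :
  strip_continuous T V -> r <= T ->
  (@lebesgue_measure R).-integrable `[0, r] (EFin \o V^~ x).
Proof.
move=> cV rT.
apply: continuous_compact_integrable; first exact: segment_compact.
apply: continuous_subspaceW (strip_section x cV).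
by apply: subset_itvl; rewrite bnd_simp.
Qed.

Lemma strip_continuous_rev (R : realType) (T : R) (V : R -> R -> R) :
  strip_continuous T V -> strip_continuous T (fun t => V (T - t)).
Proof.
move=> /strip_continuousP cV; apply/strip_continuousP => t x tT e e0.
have revT s : s \in `[0, T] -> T - s \in `[0, T] by rewrite !in_itv/=; lra.
have [d d0 dV] := cV (T - t) x (revT _ tT) e e0.
exists d => // s y sT ts xy; apply: dV => //; first exact: revT.
by rewrite (_ : _ - _ = - (t - s)) ?normrN//; ring.
Qed.

(** Heine's theorem on [-M, M], with the second point allowed to leave the
    interval.  It is uniformity in s for the two-variable function
    (s, x) |-> g(s - M + x), taken at x = 0. *)
Lemma uniformly_continuous_ball (R : realType) (g : R -> R) (M e : R) :
  continuous g -> 0 < e -> exists2 d, 0 < d &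
  forall x y, `|x| <= M -> `|x - y| < d -> `|g x - g y| < e.
Proof.
move=> cg e0; pose V s x := g (s - M + x).
have cV : strip_continuous (M + M) V.
  apply: continuous_subspaceT => -[s x].
  apply: (@continuous_comp _ _ _ (fun z : R * R => z.1 - M + z.2) g);
    last exact: cg.
  apply: cvgD; last exact: cvg_snd.
  by apply: cvgB; [exact: cvg_fst|exact: cvg_cst].
have [d d0 dV] := strip_uniform 0 cV e0.
exists d => // x y xM xy.
have xI : x + M \in `[0, M + M] by move: xM; rewrite in_itv/= ler_norml; lra.
have := dV (x + M) (y - x) xI; rewrite /V addrK addr0 sub0r opprB => /(_ xy).
by rewrite (addrC x (y - x)) subrK.
Qed.

(** * Time integrals *)

Lemma normr_Rintegral_le (R : realType) (D : set (measurableTypeR R))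
    (f : R -> R) (C l : R) :
  measurable D -> lebesgue_measure D = l%:E ->
  (@lebesgue_measure R).-integrable D (EFin \o f) ->
  (forall x, D x -> `|f x| <= C) ->
  `|\int[lebesgue_measure]_(x in D) f x| <= C * l.
Proof.
move=> mD Dl fi fC; apply: (le_trans (le_normr_Rintegral mD fi)).
have -> : C * l = \int[@lebesgue_measure R]_(x in D) C.
  by rewrite Rintegral_cst// [X in _ * fine X](_ : _ = l%:E).
apply: le_Rintegral => //; first exact: integrable_norm.
apply: (@bounded_integrable _ _ _ _ _ _ `|C|) => //.
by rewrite [ltLHS](_ : _ = l%:E) ?ltry.
Qed.

(** Varying the integrand costs the uniform distance times T; varying the upper
    bound costs the sup of the integrand times the length of the gap. *)
Lemma dist_integral_le (R : realType) (T e M r r' : R) (g g' : R -> R) :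
  0 <= r <= T -> 0 <= r' <= T ->
  (@lebesgue_measure R).-integrable `[0, T] (EFin \o g) ->
  (@lebesgue_measure R).-integrable `[0, T] (EFin \o g') ->
  (forall s, s \in `[0, T] -> `|g s - g' s| <= e) ->
  (forall s, s \in `[0, T] -> `|g' s| <= M) ->
  `|\int[lebesgue_measure]_(s in `[0, r]) g s -
    \int[lebesgue_measure]_(s in `[0, r']) g' s| <= T * e + M * `|r - r'|.
Proof.
move=> /andP[r0 rT] /andP[r'0 r'T] gi g'i gg' g'M.
have ler s u : u <= T -> s \in `[0, u] -> s \in `[0, T].
  by move=> uT; rewrite !in_itv/= => /andP[-> su]; rewrite (le_trans su uT).
have isub (f : R -> R) u : u <= T ->
  (@lebesgue_measure R).-integrable `[0, T] (EFin \o f) ->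
  (@lebesgue_measure R).-integrable `[0, u] (EFin \o f).
  move=> uT; apply: integrableS => // s /=; exact: ler.
have lm u : 0 <= u -> lebesgue_measure (`[0, u]%classic : set R) = u%:E.
  move=> u0; rewrite lebesgue_measure_itv/= lte_fin.
  by move: u0; rewrite le_eqVlt => /predU1P[<-|->]; rewrite ?ltxx// oppr0 adde0.
have lmo u v : u <= v ->
    lebesgue_measure (`]u, v]%classic : set R) = (v - u)%:E.
  move=> uv; rewrite lebesgue_measure_itv/= lte_fin.
  by move: uv; rewrite le_eqVlt => /predU1P[->|->//]; rewrite ltxx subrr.
have H u v : 0 <= u -> u <= v -> v <= T ->
    `|\int[lebesgue_measure]_(s in `[0, v]) g' s -
      \int[lebesgue_measure]_(s in `[0, u]) g' s| <= M * (v - u).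
  move=> u0 uv vT.
  rewrite Rintegral_itvB; rewrite ?bnd_simp//; last exact: isub.
  apply: normr_Rintegral_le => //; first exact: lmo.
    apply: integrableS g'i => // s /=; rewrite !in_itv/= => /andP[us sv].
    by rewrite (le_trans u0 (ltW us)) (le_trans sv vT).
  move=> s /=; rewrite in_itv/= => /andP[us sv]; apply: g'M; rewrite in_itv/=.
  by rewrite (le_trans u0 (ltW us)) (le_trans sv vT).
apply: (le_trans (ler_distD (\int[lebesgue_measure]_(s in `[0, r]) g' s) _ _)).
apply: lerD.
  rewrite -RintegralB//; [|exact: isub|exact: isub].
  apply: (@le_trans _ _ (e * r)).
    apply: normr_Rintegral_le => //; first exact: lm.
      rewrite (_ : _ \o _ = (EFin \o g) \- (EFin \o g'))%E//.
      by apply: integrableB => //; exact: isub.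
    by move=> s /= sr; apply: gg'; exact: ler sr.
  rewrite mulrC ler_wpM2r//.
  by rewrite (le_trans _ (gg' 0 _))// in_itv/= lexx (le_trans r0).
have [rr'|r'r] := leP r r'.
  rewrite distrC (distrC r) (ger0_norm (_ : 0 <= r' - r)) ?subr_ge0//.
  exact: H.
by rewrite (gtr0_norm (_ : 0 < r - r')) ?subr_gt0//; apply: H => //; exact: ltW.
Qed.

Lemma time_shift_integral (R : realType) (t T : R) (g : R -> R) : t <= T ->
  {within `[0, T - t], continuous g} ->
  \int[lebesgue_measure]_(s in `[t, T]) g (s - t) =
  \int[lebesgue_measure]_(s in `[0, T - t]) g s.
Proof.
move=> tT cg; pose F (s : R) := s - t.
have F' : derive1 F = cst 1.
  apply/funext => s; rewrite derive1E /F.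
  by rewrite deriveB// derive_id derive_cst subr0.
have cF : continuous F.
  by move=> s; apply: cvgB; [exact: cvg_id|exact: cvg_cst].
rewrite /Rintegral; congr fine.
have := @integration_by_substitution_increasing R F g t T tT.
rewrite (_ : F t = 0) ?subrr//; last exact: subrr.
rewrite (_ : F T = T - t)// => ->//.
- by apply: eq_integral => s _; rewrite /= F' /= mulr1.
- by move=> s s' _ _; rewrite /F ltrD2r.
- by rewrite F' => s _; exact: cvg_cst.
- by rewrite F'; exact: is_cvg_cst.
- by rewrite F'; exact: is_cvg_cst.
- split => //.
  + exact/cvg_at_right_filter/cF.
  + exact/cvg_at_left_filter/cF.
Qed.

Definition time_integral (R : realType) (V : R -> R -> R) (r x : R) : R :=
  \int[lebesgue_measure]_(s in `[0, r]) V s x.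

Lemma time_integral_continuous (R : realType) (T : R) (V : R -> R -> R) :
  0 < T -> strip_continuous T V ->
  strip_continuous T (fun t => time_integral V (T - t)).
Proof.
move=> T0 cV; apply/strip_continuousP => t x tT e e0.
have eT : 0 < e / (T * 2) by rewrite divr_gt0// mulr_gt0.
have [d d0 dV] := strip_uniform x cV eT.
have [C C0 CV] := strip_bounded cV (@segment_compact _ (x - d) (x + d)).
exists (Num.min d (e / (C * 2))).
  by rewrite lt_min d0 divr_gt0// mulr_gt0.
move=> s y sT; rewrite !lt_min => /andP[_ tse] /andP[xyd _].
have TT u : u \in `[0, T] -> 0 <= T - u <= T.
  by rewrite in_itv/= => /andP[u0 uT]; rewrite subr_ge0 uT lerBlDr lerDl.
apply: (@le_lt_trans _ _ (T * (e / (T * 2)) + C * `|(T - t) - (T - s)|)).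
  apply: dist_integral_le; rewrite ?TT//;
    try exact: (strip_integrable (T := T)).
    by move=> u uT; rewrite ltW// dV.
  move=> u uT; apply: CV => //=; rewrite in_itv/=.
  by move: xyd; rewrite ltr_norml; lra.
have -> : T - t - (T - s) = - (t - s) by ring.
rewrite normrN.
have -> : T * (e / (T * 2)) = e / 2 by field; rewrite gt_eqF.
move: tse; rewrite ltr_pdivlMr ?mulr_gt0//; nra.
Qed.

(** Differentiation under the integral sign: the derivative V' is bounded on
    [0, T] x [x - 1, x + 1], and this bound dominates. *)
Lemma time_integral_derive (R : realType) (T r : R) (V V' : R -> R -> R)
    (x : R) :
  strip_continuous T V -> strip_continuous T V' -> r <= T ->
  (forall t y : R, t \in `[0, T] -> is_derive y 1 (V t) (V' t y)) ->
  is_derive x 1 (time_integral V r) (time_integral V' r x).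
Proof.
move=> cV cV' rT dV.
have [C C0 CV'] := strip_bounded cV' (@segment_compact _ (x - 1) (x + 1)).
have sub s : s \in `[0, r] -> s \in `[0, T].
  by rewrite !in_itv/= => /andP[-> sr]; rewrite (le_trans sr rT).
have p1E y s : s \in `[0, T] ->
    partial1of2 (fun x s => V s x) y s = V' s y.
  move=> sT; rewrite /partial1of2 derive1E; have ? := dV s y sT.
  by rewrite derive_val.
have Ix : `]x - 1, x + 1[%classic x by rewrite /= in_itv/=; lra.
have h1 y : `]x - 1, x + 1[%classic y ->
   (@lebesgue_measure R).-integrable `[0, r] (EFin \o (fun s => V s y)).
  by move=> _; exact: strip_integrable cV rT.
have h2 y s : `]x - 1, x + 1[%classic y -> `[0, r]%classic s ->
    derivable (fun x => V s x) y 1.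
  by move=> _ /sub sT; have ? := dV s y sT; exact: ex_derive.
have h3 y s : `]x - 1, x + 1[%classic y -> `[0, r]%classic s ->
    `|partial1of2 (fun x s => V s x) y s| <= C.
  move=> yx /sub sT; rewrite p1E//; apply: CV' => //.
  by move: yx; rewrite /= !in_itv/= => /andP[h h']; rewrite !ltW.
have hC : (@lebesgue_measure R).-integrable `[0, r] (EFin \o cst C).
  apply: continuous_compact_integrable; first exact: segment_compact.
  by apply: continuous_subspaceT => ?; exact: cvg_cst.
have C0' (s : R) : 0 <= cst C s by rewrite /= ltW.
have m0r : measurable (`[0, r]%classic : set (measurableTypeR R)).
  exact: measurable_itv.
apply: DeriveDef.
  exact: (@derivable_under_integral R _ _ (@lebesgue_measure R) _ _ m0r x
    (x - 1) (x + 1) Ix h1 h2 (cst C) C0' hC h3).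
rewrite -derive1E.
rewrite (@differentiation_under_integral R _ _ (@lebesgue_measure R) _ _ m0r x
  (x - 1) (x + 1) Ix h1 h2 (cst C) C0' hC h3).
by apply: eq_Rintegral => s; rewrite inE => /sub sT; rewrite p1E.
Qed.

(** The one-sided fundamental theorem of calculus at the upper end r.  The step
    is backwards because a later time means a shorter remaining horizon, and
    only one-sided information on V is available when r = T. *)
Lemma time_integral_quotient (R : realType) (T r x : R) (V : R -> R -> R) :
  strip_continuous T V -> 0 < r <= T ->
  (time_integral V (r - h) x - time_integral V r x) / h @[h --> 0^'+] -->
    - V r x.
Proof.
move=> cV /andP[r0 rT].
apply/cvgrPdist_le => e e0.
have rI : r \in `[0, T] by rewrite in_itv/= ltW.
have [d d0 dV] := (strip_continuousP T V).1 cV r x rI e e0.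
near=> h.
have h0 : 0 < h by near: h; exact: nbhs_right_gt.
have hr : h < r by near: h; exact: nbhs_right_lt.
have hd : h < d by near: h; exact: nbhs_right_lt.
have vi := strip_integrable x cV rT.
have m1 : lebesgue_measure (`]r - h, r]%classic : set R) = h%:E.
  rewrite lebesgue_measure_itv/= lte_fin ltrBlDr ltrDl h0 -EFinD opprB.
  by rewrite addrC subrK.
have vi' : (@lebesgue_measure R).-integrable `]r - h, r] (EFin \o V^~ x).
  apply: integrableS vi => // s /=; rewrite !in_itv/= => /andP[h1 ->].
  by rewrite andbT ltW// (le_lt_trans _ h1)// subr_ge0 ltW.
have ci : (@lebesgue_measure R).-integrable `]r - h, r] (EFin \o cst (V r x)).
  apply: (@bounded_integrable _ _ _ _ _ _ `|V r x|) => //.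
  by rewrite [ltLHS](_ : _ = h%:E) ?ltry.
rewrite -mulNr opprB addrC.
rewrite /time_integral Rintegral_itvB; [|exact: vi
  |by rewrite bnd_simp subr_ge0 ltW|by rewrite bnd_simp gerBl ltW].
have -> : V r x = (\int[lebesgue_measure]_(s in `]r - h, r]) V r x) / h.
  by rewrite Rintegral_cst// [X in _ * fine X](_ : _ = h%:E)// mulfK// gt_eqF.
rewrite -mulrBl -RintegralB// normrM normfV (gtr0_norm h0) ler_pdivrMr//.
apply: normr_Rintegral_le => //.
  rewrite (_ : _ \o _ = (EFin \o V^~ x) \- (EFin \o cst (V r x)))%E//.
  by apply: integrableB.
move=> s /=; rewrite in_itv/= => /andP[hs sr]; rewrite ltW// distrC dV//.
- rewrite in_itv/= (le_trans sr rT) andbT ltW// (le_lt_trans _ hs)//.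
  by rewrite subr_ge0 ltW.
- by rewrite ger0_norm ?subr_ge0//; move: hs hd; lra.
- by rewrite subrr normr0.
Unshelve. all: by end_near. Qed.

(** * Functionals continuous on the space of stopped paths *)

Lemma stopped_eval (R : realType) (T t u : R) (w : Dpath T) :
  stopped_paths (t, w) -> t <= u <= T -> w u = w t.
Proof.
move=> [/= /andP[t0 tT] <-] /andP[tu uT].
by rewrite !stopE ?minxx ?min_r// in_itv/= ?t0 ?tT// uT (le_trans t0).
Qed.

Lemma stopped_stop (R : realType) (T t : R) (w : Dpath T) :
  0 <= t <= T -> stopped_paths (t, stop t w).
Proof.
move=> tT; split => //=; apply: Dpath_eq => u uT.
rewrite stopE// stopE ?stopE// ?minAxx//.
  by rewrite -minA minxx.
move: uT tT; rewrite !in_itv/= => /andP[u0 uT] /andP[t0 _].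
by rewrite le_min u0 t0/= ge_min uT.
Qed.

Lemma stopped_later (R : realType) (T t t' : R) (w : Dpath T) :
  stopped_paths (t, w) -> t <= t' <= T -> stopped_paths (t', w).
Proof.
move=> sw /andP[tt' t'T]; have [/= /andP[t0 tT] _] := sw.
split => /=; first by rewrite t'T (le_trans t0).
apply: Dpath_eq => u uT; rewrite stopE//.
have [ut'|t'u] := leP u t'; first by [].
rewrite (stopped_eval (u := t') sw) ?tt'//.
rewrite (stopped_eval (u := u) sw)// (le_trans tt' (ltW t'u)).
by move: uT; rewrite in_itv => /andP[].
Qed.

Lemma stopped_vbump (R : realType) (T t x : R) (w : Dpath T) :
  stopped_paths (t, w) -> stopped_paths (t, vbump t x w).
Proof.
move=> sw; have [/= /andP[t0 tT] _] := sw.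
split => /=; first by rewrite t0.
apply: Dpath_eq => u uT; rewrite stopE// !vbumpE//; last first.
  move: uT; rewrite !in_itv/= => /andP[u0 uT].
  by rewrite le_min u0 t0/= ge_min uT.
by rewrite -minA minxx le_min lexx andbT.
Qed.

(** The endpoint of a stopped path is its value at T, whatever the time at
    which it is stopped, so endpoints at different times can be compared by the
    sup norm. *)
Lemma stopped_end_dist (R : realType) (T : R) (p q : R * Dpath T) :
  stopped_paths p -> stopped_paths q ->
  `|p.2 p.1 - q.2 q.1| <= sup_norm T (p.2 \- q.2).
Proof.
move: p q => [t w] [t' w'] sw sw' /=.
have [/= /andP[t0 tT] _] := sw; have [/= /andP[t'0 t'T] _] := sw'.
rewrite -(stopped_eval (u := T) sw) ?tT ?lexx//.
rewrite -(stopped_eval (u := T) sw') ?t'T ?lexx//.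
by apply: le_sup_norm; rewrite in_itv/= lexx (le_trans t0 tT).
Qed.

(** Continuity for the metric d_infty on stopped paths: a two-sided
    strengthening of left-continuity. *)
Definition stopped_continuous (R : realType) (T : R)
    (F : R * Dpath T -> R) : Prop :=
  forall p, stopped_paths p -> forall e : R, 0 < e ->
  exists2 d, 0 < d &
    forall q, stopped_paths q -> d_infty p q < d -> `|F p - F q| < e.

(** Preimages of open intervals are d_infty-open, and open intervals generate
    the Borel sigma-algebra. *)
Lemma stopped_continuous_nonanticipative (R : realType) (T : R)
    (F : R * Dpath T -> R) : stopped_continuous F -> nonanticipative F.
Proof.
move=> cF B mB.
have {}mB : <<s @RGenOpens.G R >> B.
  have := mB.
  rewrite -[measurable _]/(measurable (B : set (measurableTypeR R))).
  by rewrite RGenOpens.measurableE.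
pose S : set (set R) :=
  [set A | <<s stopped_paths (T := T), d_infty_open (T := T) >>
    (stopped_paths (T := T) `&` F @^-1` A)].
suff : <<s @RGenOpens.G R >> `<=` S by move=> /(_ B mB).
have [s0 sC sU] :=
  @smallest_sigma_algebra _ (stopped_paths (T := T)) (d_infty_open (T := T)).
apply: smallest_sub; first split => /=.
- by rewrite /S/= preimage_set0 setI0.
- move=> A SA; rewrite /S/= setTD.
  rewrite (_ : _ `&` _ = stopped_paths (T := T) `\`
    (stopped_paths (T := T) `&` F @^-1` A)); first exact: sC.
  apply/seteqP; split => z /= [sz nA]; split => //.
    by move=> [_ Az]; exact: nA.
  by move=> Az; apply: nA.
- move=> A SA; rewrite /S/= preimage_bigcup setI_bigcupr; exact: sU.
move=> _ [a [b ->]]; apply: sub_sigma_algebra; split; first by move=> z [].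
move=> p [sp /=]; rewrite in_itv/= => /andP[aF Fb].
have e0 : 0 < Num.min (F p - a) (b - F p) by rewrite lt_min !subr_gt0 aF.
have [d d0 dF] := cF p sp _ e0.
exists d => // q sq pq; split => //=; rewrite in_itv/=.
have := dF q sq pq; rewrite lt_min !ltr_norml.
by move=> /andP[/andP[h1 h2] /andP[h3 h4]]; lra.
Qed.

(** For continuity at a fixed time, note that stopping two paths at the same
    time does not increase their uniform distance. *)
Lemma stopped_continuous_left (R : realType) (T : R) (F : R * Dpath T -> R) :
  stopped_continuous F -> left_continuous F.
Proof.
move=> cF; split; first exact: stopped_continuous_nonanticipative.
- move=> t w /andP[t0 tT] e e0.
  have tT' : 0 <= t <= T by rewrite t0 ltW.
  have [d d0 dF] := cF _ (stopped_stop w tT') e e0.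
  exists d => // w' ww'; apply: dF; first exact: stopped_stop.
  rewrite /d_infty/= subrr normr0 addr0; apply: le_lt_trans ww'.
  apply: sup_norm_le => [|u uT]; first by rewrite (le_trans t0 (ltW tT)).
  change (`|stop t w u - stop t w' u| <= sup_norm T (w \- w')).
  rewrite !stopE//; apply: le_sup_norm.
  move: uT; rewrite !in_itv/= => /andP[u0 uT].
  by rewrite le_min u0 t0/= ge_min uT.
- move=> p sp e e0; have [d d0 dF] := cF p sp e e0.
  by exists d => // q sq _; exact: dF.
Qed.

Lemma stopped_continuousD (R : realType) (T : R) (F G : R * Dpath T -> R) :
  stopped_continuous F -> stopped_continuous G ->
  stopped_continuous (F \+ G).
Proof.
move=> cF cG p sp e e0; have e2 : 0 < e / 2 by rewrite divr_gt0.
have [d d0 dF] := cF p sp _ e2; have [d' d'0 dG] := cG p sp _ e2.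
exists (Num.min d d'); first by rewrite lt_min d0.
move=> q sq; rewrite lt_min => /andP[pd pd'].
rewrite /= opprD addrACA (splitr e) (le_lt_trans (ler_normD _ _))//.
by rewrite ltrD// ?dF// dG.
Qed.

Lemma eq_stopped_continuous (R : realType) (T : R) (F G : R * Dpath T -> R) :
  (forall p, stopped_paths p -> F p = G p) ->
  stopped_continuous G -> stopped_continuous F.
Proof.
move=> FG cG p sp e e0; have [d d0 dG] := cG p sp e e0.
by exists d => // q sq pq; rewrite !FG//; exact: dG.
Qed.

Definition markovian (R : realType) (T : R) (K : R -> R -> R)
    (q : R * Dpath T) : R :=
  K q.1 (q.2 q.1).

Lemma markovian_continuous (R : realType) (T : R) (K : R -> R -> R) :
  strip_continuous T K -> stopped_continuous (T := T) (markovian K).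
Proof.
move=> /strip_continuousP cK p sp e e0.
have pT : p.1 \in `[0, T] by rewrite in_itv; case: sp.
have [d d0 dK] := cK p.1 (p.2 p.1) pT e e0.
exists d => // q sq pq; apply: dK; first by rewrite in_itv; case: sq.
- rewrite (le_lt_trans _ pq)// lerDr.
  by rewrite (le_trans _ (stopped_end_dist sp sq)).
- rewrite (le_lt_trans _ pq)// (le_trans (stopped_end_dist sp sq))//.
  by rewrite lerDl.
Qed.

Lemma markovian_regular (R : realType) (T : R) (K : R -> R -> R)
    (F : R * Dpath T -> R) :
  strip_continuous T K -> (forall p, stopped_paths p -> F p = markovian K p) ->
  left_continuous F /\ boundedness_preserving F.
Proof.
move=> cK FK.
have cF : stopped_continuous F.
  exact: (eq_stopped_continuous FK (markovian_continuous cK)).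
split; first exact: stopped_continuous_left.
split; first exact: stopped_continuous_nonanticipative.
move=> A t0 cA t0T; have [C C0 CK] := strip_bounded cK cA.
exists C => // t w /andP[t_ge0 tt0] wA.
have tT : 0 <= t <= T by rewrite t_ge0 (le_trans tt0 (ltW t0T)).
rewrite FK; last exact: stopped_stop.
have tI : t \in `[0, T] by rewrite in_itv.
rewrite /markovian [_.1]/= stopE// minxx; apply: CK => //.
by apply: wA; rewrite t_ge0 lexx.
Qed.

(** When F depends on a vertical bump only through the endpoint, its vertical
    derivative is an ordinary derivative.  The result is again a Markovian
    functional, so the lemma can be iterated. *)
Lemma vertical_derivativeE (R : realType) (T : R) (F c : R * Dpath T -> R)
    (K K' : R -> R -> R) :
  (forall t w x, stopped_paths (t, w) ->
    F (t, vbump t x w) = c (t, w) + K t (w t + x)) ->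
  (forall t y : R, t \in `[0, T] -> is_derive y 1 (K t) (K' t y)) ->
  vertically_differentiable F /\
  forall p, stopped_paths p -> vertical_derivative F p = markovian K' p.
Proof.
move=> FK dK.
have H t w : stopped_paths (t, w) ->
    is_derive (0 : R) 1 (fun x : R => F (t, vbump t x w)) (K' t (w t)).
  move=> sw; have tT : t \in `[0, T] by rewrite in_itv; case: sw.
  have -> : (fun x => F (t, vbump t x w)) =
      cst (c (t, w)) + (K t \o (fun x => w t + x)).
    by apply/funext => x; rewrite FK.
  have dK' := dK t (w t + 0) tT.
  have d1 : is_derive (0 : R) 1 (fun x : R => w t + x) 1.
    rewrite (_ : (fun x : R => w t + x) = cst (w t) + id)//.
    by apply: is_derive_eq; rewrite add0r.
  have := is_derive1_comp (f := K t) dK' d1.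
  by move=> d2; apply: is_derive_eq; rewrite add0r mulr1 addr0.
split=> [[t w] sw|[t w] sw]; first by have ? := H t w sw; exact: ex_derive.
by have ? := H t w sw; rewrite /vertical_derivative/= derive1E derive_val.
Qed.

Lemma markovian_vbump (R : realType) (T t x : R) (w : Dpath T)
    (K : R -> R -> R) :
  stopped_paths (t, w) -> markovian K (t, vbump t x w) = K t (w t + x).
Proof.
move=> [/= tT _]; have tI : t \in `[0, T] by rewrite in_itv.
by rewrite /markovian [_.1]/= vbumpE// minxx lexx.
Qed.

(** * The integral over the past *)

Lemma path_integrable (R : realType) (T M r : R) (w : Dpath T) (g : R -> R) :
  0 <= T -> measurable_fun setT g -> (forall x, `|g x| <= M) ->
  (@lebesgue_measure R).-integrable `[0, r] (EFin \o (g \o w)).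
Proof.
move=> T0 mg gM.
have fin : (lebesgue_measure (`[0%R, r]%classic : set R) < +oo)%E.
  by rewrite lebesgue_measure_itv/=; case: ifP; rewrite ?ltry.
apply: (@bounded_integrable _ _ _ _ _ _ M) => //.
- apply: measurable_funTS; apply: measurableT_comp => //.
  exact: measurable_Dpath.
- by move=> x _; exact: gM.
Qed.

Definition past_integral (R : realType) (T : R) (g : R -> R)
    (p : R * Dpath T) : R :=
  \int[lebesgue_measure]_(s in `[0, p.1]) g (p.2 s).

(** The limit path w is bounded, so g is uniformly continuous around its range
    and nearby paths have uniformly close images. *)
Lemma past_integral_continuous (R : realType) (T : R) (g : R -> R) :
  0 < T -> Cb g -> stopped_continuous (T := T) (past_integral g).
Proof.
move=> T0 [cg [M gM]] [t w] sw e e0.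
have [N wN] := Dpath_bounded w.
have eT : 0 < e / (T * 2) by rewrite divr_gt0// mulr_gt0.
have [d d0 dg] := uniformly_continuous_ball N cg eT.
have M0 : 0 <= M by rewrite (le_trans _ (gM 0)).
have M1 : 0 < M + 1 by rewrite ltr_pwDr.
exists (Num.min d (e / ((M + 1) * 2))).
  by rewrite lt_min d0 divr_gt0// mulr_gt0.
move=> [t' w'] sw'; rewrite /d_infty/= lt_min => /andP[wd td].
have s0 : 0 <= sup_norm T (w \- w').
  exact: (le_trans _ (stopped_end_dist sw sw')).
have mg := continuous_measurable_fun cg.
apply: (@le_lt_trans _ _ (T * (e / (T * 2)) + (M + 1) * `|t - t'|)).
  apply: dist_integral_le; [by case: sw|by case: sw'| | | |].
  - exact: (path_integrable T w (ltW T0) mg gM).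
  - exact: (path_integrable T w' (ltW T0) mg gM).
  - move=> s sT; rewrite ltW// dg//.
    by rewrite (le_lt_trans (le_sup_norm w w' sT))// (le_lt_trans _ wd)// lerDl.
  - by move=> s _; rewrite (le_trans (gM _))// lerDl.
have -> : T * (e / (T * 2)) = e / 2 by field; rewrite gt_eqF.
have : `|t - t'| < e / ((M + 1) * 2) by rewrite (le_lt_trans _ td)// lerDr.
rewrite ltr_pdivlMr ?mulr_gt0//; nra.
Qed.

(** The bump changes the path on [0, t] only at the instant t, a null set. *)
Lemma past_integral_vbump (R : realType) (T t x : R) (w : Dpath T)
    (g : R -> R) :
  0 <= T -> Cb g -> stopped_paths (t, w) ->
  past_integral g (t, vbump t x w) = past_integral g (t, w).
Proof.
move=> T0 [cg [M gM]] [/= /andP[t0 tT] _].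
have mg := continuous_measurable_fun cg.
have co (v : Dpath T) : past_integral g (t, v) =
    \int[lebesgue_measure]_(s in `[0, t[) g (v s).
  rewrite /past_integral Rintegral_itv_bndo_bndc//.
  apply: integrableS (path_integrable t v T0 mg gM) => //.
  by apply: subset_itvl; rewrite bnd_simp.
rewrite !co; apply: eq_Rintegral => s; rewrite inE/= in_itv/= => /andP[s0 st].
change (g (vbump t x w s) = g (w s)).
rewrite vbumpE; last by rewrite in_itv/= s0 (le_trans (ltW st) tT).
by rewrite leNgt st/= addr0 min_l// ltW.
Qed.

(** * The conditional expectation of the integral functional *)

(** The closed form of the conditional expectation.  The expected integrand is
    the function h below, which is g(w_s) before t and u(s - t, w_t) after; the
    two expressions agree at s = t because the semigroup is the identity at time
    0. *)
Lemma cond_functionalE (R : realType) (T : R) (p : R -> R.-pker R ~> R)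
    (g : R -> R) (Q : R * Dpath T -> probability (Dpath T) R) :
  0 < T -> Cb g -> semigroup p 0 g = g ->
  strip_continuous T (fun t x => semigroup p t g x) ->
  semigroup_version p g Q ->
  forall q, stopped_paths q ->
  cond_functional Q (integral_functional g) q =
  past_integral g q +
  time_integral (fun t x => semigroup p t g x) (T - q.1) (q.2 q.1).
Proof.
move=> T0 [cg [M gM]] p0 cu Qv [t w] sw.
have [/= /andP[t0 tT] _] := sw.
have mg := continuous_measurable_fun cg.
rewrite /cond_functional /integral_functional (Fubini_time _ (ltW T0) mg gM).
pose h (s : R) := if t <= s then semigroup p (s - t) g (w t) else g (w s).
have hE s : s \in `[0, T] -> \int[Q (t, w)]_w' g (w' s) = h s.
  by rewrite in_itv => sT; exact: Qv.
have cut : {within `[0, T - t], continuous (fun s => semigroup p s g (w t))}.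
  apply: continuous_subspaceW (strip_section (w t) cu).
  by apply: subset_itvl; rewrite bnd_simp gerBl.
have uI : (@lebesgue_measure R).-integrable `[t, T]
    (EFin \o (fun s => semigroup p (s - t) g (w t))).
  apply: continuous_compact_integrable; first exact: segment_compact.
  apply/subspace_continuousP => s /= sT.
  apply/cvgrPdist_lt => e e0.
  have ts : s - t \in `[0, T] by move: sT; rewrite !in_itv/=; lra.
  have [d d0 dV] := (strip_continuousP T _).1 cu (s - t) (w t) ts e e0.
  apply/nbhs_ballP; exists d => //= s' ss' s'T.
  apply: dV; [|by rewrite opprB addrA subrK|by rewrite subrr normr0].
  by move: s'T; rewrite /= !in_itv/=; lra.
have hP : {in `[0, t], h =1 g \o w}.
  move=> s; rewrite in_itv/= => /andP[s0 st]; rewrite /h; case: ifPn => // ts.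
  have -> : s = t by apply/eqP; rewrite eq_le st.
  by rewrite subrr p0.
have hF : {in `]t, T], h =1 (fun s => semigroup p (s - t) g (w t))}.
  by move=> s; rewrite in_itv/= => /andP[ts _]; rewrite /h ltW.
have hFi : (@lebesgue_measure R).-integrable `]t, T] (EFin \o h).
  have : (@lebesgue_measure R).-integrable `]t, T]
      (EFin \o (fun s => semigroup p (s - t) g (w t))).
    by apply: integrableS uI => //; apply: subset_itvr; rewrite bnd_simp.
  by apply: eq_integrable => // s; rewrite inE/= => /hF ->.
have hPi : (@lebesgue_measure R).-integrable `[0, t] (EFin \o h).
  have := path_integrable t w (ltW T0) mg gM.
  by apply: eq_integrable => // s; rewrite inE/= => /hP ->.
have hI : (@lebesgue_measure R).-integrable `[0, T] (EFin \o h).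
  have [C C0 uC] := strip_bounded cu (@compact_set1 _ (w t)).
  have Tfin : (lebesgue_measure (`[0%R, T]%classic : set R) < +oo)%E.
    by rewrite lebesgue_measure_itv/=; case: ifP; rewrite ?ltry.
  apply: (@bounded_integrable _ _ _ _ _ _ (Num.max C M)) => //.
    rewrite (@itv_bndbnd_setU _ _ _ (BRight t))//; rewrite ?bnd_simp//.
    apply/measurable_funU => //; split; apply/measurable_EFinP.
      exact: measurable_int hPi.
    exact: measurable_int hFi.
  move=> s /=; rewrite in_itv/= => /andP[s0 sT]; rewrite /h le_max.
  case: ifPn => ts; last by rewrite gM orbT.
  by rewrite uC// in_itv/=; lra.
transitivity (\int[@lebesgue_measure R]_(s in `[0, T]) h s).
  by apply: eq_Rintegral => s; rewrite inE => /hE.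
rewrite -[LHS](subrKC (\int[lebesgue_measure]_(s in `[0, t]) h s)).
rewrite Rintegral_itvB ?bnd_simp//; congr (_ + _).
  by apply: eq_Rintegral => s; rewrite inE => /hP.
transitivity (\int[@lebesgue_measure R]_(s in `]t, T])
    semigroup p (s - t) g (w t)).
  by apply: eq_Rintegral => s; rewrite inE => /hF.
rewrite Rintegral_itv_obnd_cbnd; last first.
  by apply: integrableS uI => //; apply: subset_itvr; rewrite bnd_simp.
exact: (time_shift_integral tT cut).
Qed.

(** A stopped path is constant after its stopping time: over [t, t + h] the past
    integral grows by exactly h g(w_t), and the endpoint entering the second
    term does not move. *)
Lemma horizontal_quotient_cvg (R : realType) (T : R) (F : R * Dpath T -> R)
    (g : R -> R) (u : R -> R -> R) :
  0 < T -> Cb g -> strip_continuous T u ->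
  (forall q, stopped_paths q ->
    F q = past_integral g q + time_integral u (T - q.1) (q.2 q.1)) ->
  forall q, stopped_paths q -> q.1 < T ->
  horizontal_quotient F q h @[h --> 0^'+] -->
    g (q.2 q.1) - u (T - q.1) (q.2 q.1).
Proof.
move=> T0 [cg [M gM]] cu FE [t w] sw /= tT; have [/= /andP[t0 _] sww] := sw.
have mg := continuous_measurable_fun cg.
have r0 : 0 < T - t <= T by rewrite subr_gt0 tT gerBl.
have := time_integral_quotient (x := w t) cu r0.
move=> /(cvgD (cvg_cst (g (w t)))).
apply: cvg_trans; apply: near_eq_cvg; near=> h.
have h0 : 0 < h by near: h; exact: nbhs_right_gt.
have hT : h < T - t by near: h; apply: nbhs_right_lt; rewrite subr_gt0.
have thT : t <= t + h <= T by lra.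
rewrite /horizontal_quotient [_.1]/= [_.2]/= sww !FE//=; last first.
  exact: stopped_later sw thT.
rewrite (stopped_eval sw thT) (opprD (past_integral _ _)) addrACA.
rewrite [in RHS]mulrDl; congr (_ + _); last first.
  by rewrite opprD addrA.
rewrite /past_integral/= Rintegral_itvB; [|
  exact: (path_integrable (t + h) w (ltW T0) mg gM)
  |by rewrite bnd_simp|by rewrite bnd_simp; lra].
rewrite (_ : Rintegral _ _ _ =
    \int[@lebesgue_measure R]_(s in `]t, t + h]) g (w t)).
  rewrite Rintegral_cst// [X in _ * fine X](_ : _ = h%:E).
    by rewrite mulfK// gt_eqF.
  rewrite [LHS]lebesgue_measure_itv/= lte_fin ltrDl h0 -EFinD addrAC.
  by rewrite subrr add0r.
apply: eq_Rintegral => s; rewrite inE/= in_itv/= => /andP[ts sth].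
rewrite (stopped_eval (u := s) sw)// (ltW ts) (le_trans sth)//.
by case/andP: thT.
Unshelve. all: by end_near. Qed.

(** * Regularity of the conditional expectation *)

Unset Implicit Arguments.

Theorem proposition4p6 (R : realType) (T : R) (T_gt0 : 0 < T)
  (P : probability (Dpath T) R)
  (p : R -> R.-pker R ~> R)
  (X_start : P [set w : Dpath T | coord_process 0 w = 0] = 1%E)
  (X_Feller : Cb_Feller_semimartingale T P
     (natural_filtration (@coord_process R T)) (@coord_process R T) p)
  (ft : R -> R) (ft_Cb : Cb ft)
  (ft_C12 : C12 T (fun t x => semigroup p t ft x))
  (Q : R * Dpath T -> probability (Dpath T) R)
  (Q_cond : regular_conditional_law P Q)
  (Q_version : semigroup_version p ft Q) :
  C12b (cond_functional Q (integral_functional ft)).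
Proof.
have [_ _ [_ p0 _ _]] := X_Feller.
have u0 := p0 ft ft_Cb.
case: ft_C12 => ut [_ du cu _ [cu1 cu2]].
set u := fun t x => semigroup p t ft x in du cu cu1 cu2 *.
set F := cond_functional _ _.
have FE := cond_functionalE T_gt0 ft_Cb u0 cu Q_version.
rewrite -/F -/u in FE.
pose u1 t := derive1 (u t); pose u2 t := derive1 (u1 t).
have du1 (t y : R) : t \in `[0, T] -> is_derive y 1 (u t) (u1 t y).
  rewrite in_itv => tT; rewrite /u1 derive1E; apply: DeriveDef => //.
  by case: (du t y tT).
have du2 (t y : R) : t \in `[0, T] -> is_derive y 1 (u1 t) (u2 t y).
  rewrite in_itv => tT; rewrite /u2 derive1E; apply: DeriveDef => //.
  by case: (du t y tT).
have sub t : t \in `[0, T] -> T - t <= T by rewrite in_itv/=; lra.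
have dU (t y : R) : t \in `[0, T] ->
    is_derive y 1 (time_integral u (T - t)) (time_integral u1 (T - t) y).
  by move=> tT; apply: (time_integral_derive _ cu cu1) => //; exact: sub.
have dU1 (t y : R) : t \in `[0, T] ->
    is_derive y 1 (time_integral u1 (T - t)) (time_integral u2 (T - t) y).
  by move=> tT; apply: (time_integral_derive _ cu1 cu2) => //; exact: sub.
have FV t w x : stopped_paths (t, w) -> F (t, vbump t x w) =
    past_integral ft (t, w) + time_integral u (T - t) (w t + x).
  move=> sw; rewrite FE; last exact: stopped_vbump.
  rewrite past_integral_vbump//; last exact: ltW.
  congr (_ + _).
  exact: (markovian_vbump x (fun t => time_integral u (T - t)) sw).
have [dF F1E] := vertical_derivativeE FV dU.
have FV1 t w x : stopped_paths (t, w) ->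
    vertical_derivative F (t, vbump t x w) =
    cst 0 (t, w) + time_integral u1 (T - t) (w t + x).
  move=> sw; rewrite F1E; last exact: stopped_vbump.
  by rewrite markovian_vbump//= add0r.
have [dF1 F2E] := vertical_derivativeE FV1 dU1.
have hq := horizontal_quotient_cvg T_gt0 ft_Cb cu FE.
pose D t x := ft x - u (T - t) x.
have HE q : stopped_paths q -> horizontal_derivative F q = markovian D q.
  move=> sq; rewrite /horizontal_derivative; case: ifPn => [qT|].
    by apply/cvg_lim => //; exact: hq.
  (* At t = T the convention that the derivative vanishes agrees with the
     formula, since the semigroup is the identity at time 0. *)
  rewrite -leNgt => Tq; have qT : q.1 = T.
    by apply/eqP; rewrite eq_le Tq andbT; case: sq => /andP[].
  by rewrite /markovian /D qT subrr /u u0 subrr.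
have cD : strip_continuous T D.
  have c1 : strip_continuous T (fun=> ft).
    apply: continuous_subspaceT => z.
    by apply: (@continuous_comp _ _ _ snd ft); [exact: cvg_snd|exact: ft_Cb.1].
  have c2 : strip_continuous T (fun t => u (T - t)).
    exact: strip_continuous_rev.
  by move=> z; apply: (cvgB (c1 z) (c2 z)).
have [lH bH] := markovian_regular cD HE.
have [lV bV] := markovian_regular (time_integral_continuous T_gt0 cu1) F1E.
have [lV2 bV2] := markovian_regular (time_integral_continuous T_gt0 cu2) F2E.
split => //.
- apply: stopped_continuous_left; apply: (eq_stopped_continuous FE).
  apply: stopped_continuousD; first exact: past_integral_continuous.
  apply: (markovian_continuous (K := fun t => time_integral u (T - t))).
  exact: time_integral_continuous.
- by move=> q sq qT; apply/cvg_ex; eexists; exact: hq.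
- by split => //; case: lH.
Qed.
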